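(* Let $k$ be a field, and let $a,b\in\mathbb{Z}_{>1}$ be such that $\gcd(a,b)=1$ and $a>b$. Then $P_{a,b}=P_\nu$, where $\nu$ is the monomial valuation on $k(x,y)$ given by $\nu(x)=a$ and $\nu(y)=b$.
   Context: The monomial valuation $\nu$ on $k(x,y)$ with $\nu(x)=a$, $\nu(y)=b$ is defined on nonzero polynomials by $\nu\left(\sum_{i,j}\lambda_{ij}x^iy^j\right)=\min\{ia+jb : \lambda_{ij}\neq 0\}$, with $\nu(0)=\infty$, and extended to $k(x,y)$ by $\nu(f/g)=\nu(f)-\nu(g)$. The tree $T$ (valuation tree, also called coordinate tree) is the directed graph whose vertices are certain subrings $k[f,g]$ of $k(x,y)$ (each coming with its displayed pair of generators $f,g$, which are Laurent monomials in $x,y$), defined recursively: $k[x,y]$ is a vertex; and if $k[f,g]$ is a vertex, then $k[f,g/f]$ and $k[g,f/g]$ are vertices, with a directed edge from $k[f,g]$ to each of them. Each vertex $k[f,g]$ is the coordinate ring of an affine chart isomorphic to $\mathbb{A}^2$ with coordinates $f,g$; its two successors are the coordinate rings of the two standard charts of the blow-up of this chart at its origin. The composite of the blow-up maps gives a morphism from the chart to $\mathbb{A}^2=\mathbb{A}^2_{(x,y)}$, corresponding to the inclusion $k[x,y]\subset k[f,g]$. A vertex $k[f,g]$ is $\nu$-positive if $\nu(f)>0$ and $\nu(g)>0$. $P_\nu$ is the subgraph of $T$ whose vertices are the $\nu$-positive vertices of $T$. A curve $C=C_1\cup\dots\cup C_n$ ($C_i$ its irreducible components) on a surface is resolved if (1)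 each $C_i$ is smooth; (2) no three components meet at a point; (3) no two components are tangent at any point, i.e. if $C_i$ and $C_j$ ($i\ne j$) meet at a point then their tangent lines there are different. $C$ has normal crossings if (2) and (3) hold; a non-normal crossing is a point where (2) or (3) fails. Let $V=\mathbb{V}(x^b-y^a)\subset\mathbb{A}^2$. $P_{a,b}$ is the subgraph of $T$ whose vertices are those vertices of $T$ in whose chart the preimage of $V$ (the full preimage, including exceptional components, taken with its reduced irreducible components) has either a singular component or a non-normal crossing, i.e. is not resolved. *)

(* Defs.v *)
From HB Require Import structures.
From mathcomp Require Import all_boot all_order all_algebra.
From mathcomp Require Import generic_quotient fraction mpoly.

Set Implicit Arguments.
Unset Strict Implicit.
Unset Printing Implicit Defensive.

Import GRing.Theory Num.Theory.
Local Open Scope ring_scope.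

Definition pair_fun (S : Type) (s t : S) : 'I_2 -> S :=
  fun i => if i == ord0 then s else t.

(** ** Plane curves

   A plane curve over [k] is given by a polynomial [G] in [k[u,v]].  Its
   irreducible components are the curves [F = 0] for [F] an irreducible factor
   of [G]; multiplicities are ignored, and two factors give the same component
   exactly when they differ by a unit.

   As [k] is not assumed algebraically closed, a point of the plane is a point
   with coordinates in an arbitrary extension field [L] of [k], given by a ring
   morphism [iota : k -> L].  In particular all geometric points occur, so that
   smoothness below is smoothness over [k]. *)

Definition irreducible_elt (R : idomainType) (p : R) : Prop :=
  [/\ p != 0, p \isn't a GRing.unit &
      forall q r : R, p = q * r -> q \is a GRing.unit \/ r \is a GRing.unit].

Definition associated (R : idomainType) (p q : R) : Prop :=
  exists2 u : R, u \is a GRing.unit & q = u * p.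

Section PlaneCurves.

Variable k : fieldType.
Implicit Types F G : {mpoly k[2]}.

Definition component G F : Prop :=
  irreducible_elt F /\ exists H : {mpoly k[2]}, G = F * H.

Section Points.

Variables (L : fieldType) (iota : {rmorphism k -> L}) (s t : L).

Definition eval_at F : L := mmap iota (pair_fun s t) F.

Definition on_curve F : Prop := eval_at F = 0.

Definition du F : L := eval_at (mderiv (ord0 : 'I_2) F).
Definition dv F : L := eval_at (mderiv (ord_max : 'I_2) F).

Definition singular_at F : Prop := [/\ on_curve F, du F = 0 & dv F = 0].

(* The directions of the tangent space at [(s, t)]; this is a line when
   [(s, t)] is a smooth point of [F = 0]. *)
Definition tangent_space F (l m : L) : Prop := du F * l + dv F * m = 0.

Definition tangent_at F1 F2 : Prop :=
  [/\ on_curve F1, on_curve F2 &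
      forall l m : L, tangent_space F1 l m <-> tangent_space F2 l m].

End Points.

Definition smooth_curve F : Prop :=
  forall (L : fieldType) (iota : {rmorphism k -> L}) (s t : L),
    ~ singular_at iota s t F.

Definition smooth_components G : Prop :=
  forall F, component G F -> smooth_curve F.

Definition no_triple_point G : Prop :=
  forall F1 F2 F3, component G F1 -> component G F2 -> component G F3 ->
    ~ associated F1 F2 -> ~ associated F1 F3 -> ~ associated F2 F3 ->
  forall (L : fieldType) (iota : {rmorphism k -> L}) (s t : L),
    ~ [/\ on_curve iota s t F1, on_curve iota s t F2 & on_curve iota s t F3].

Definition no_tangency G : Prop :=
  forall F1 F2, component G F1 -> component G F2 -> ~ associated F1 F2 ->
  forall (L : fieldType) (iota : {rmorphism k -> L}) (s t : L),
    ~ tangent_at iota s t F1 F2.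

Definition normal_crossings G : Prop := no_triple_point G /\ no_tangency G.

Definition resolved G : Prop := smooth_components G /\ normal_crossings G.

End PlaneCurves.

(** ** Directed graphs *)

Record digraph (V : Type) := Digraph {
  vertices : V -> Prop;
  edges : V -> V -> Prop
}.

Definition induced_subgraph (V : Type) (T : digraph V) (P : V -> Prop) :
    digraph V :=
  Digraph (fun c => vertices T c /\ P c)
          (fun c d => [/\ edges T c d, P c & P d]).

(** ** The function field, the valuation and the tree *)

Section Tree.

Variable k : fieldType.

Definition kxy : fieldType := {fraction {mpoly k[2]}}.

Definition polyx : {mpoly k[2]} := mpolyX k (mnm1 (ord0 : 'I_2)).
Definition polyy : {mpoly k[2]} := mpolyX k (mnm1 (ord_max : 'I_2)).

Definition embed (p : {mpoly k[2]}) : kxy := FracField.tofrac p.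

Definition fx : kxy := embed polyx.
Definition fy : kxy := embed polyy.

(* [subst f g G] is the element [G(f, g)] of [k(x,y)]. *)
Definition subst (f g : kxy) (G : {mpoly k[2]}) : kxy :=
  mmap (fun c : k => embed (mpolyC 2 c)) (pair_fun f g) G.

Section MonomialValuation.

Variables a b : nat.

Definition weight (m : 'X_{1..2}) : nat :=
  (m (ord0 : 'I_2) * a + m (ord_max : 'I_2) * b)%N.

(* The minimum over the support of [p]; when [p != 0], [mlead p] belongs to the
   support, so that the default value does not affect the minimum. *)
Definition min_weight (p : {mpoly k[2]}) : nat :=
  \big[minn/weight (mlead p)]_(m <- msupp p) weight m.

(* [None] stands for infinity.  The fraction [z] is the quotient of the
   numerator and denominator of its chosen representative; the value does not
   depend on that choice. *)
Definition monomial_valuation (z : kxy) : option int :=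
  if z == 0 then None
  else Some ((min_weight (frac (repr z)).1)%:Z
             - (min_weight (frac (repr z)).2)%:Z).

End MonomialValuation.

Definition positive_value (v : option int) : Prop :=
  if v is Some n then 0 < n else True.

Record chart := Chart {
  coord_ring : kxy -> Prop;
  gen1 : kxy;
  gen2 : kxy
}.

(* The subring [k[f,g]] of [k(x,y)] with its displayed pair of generators. *)
Definition adjoin (f g : kxy) : chart :=
  Chart (fun z => exists G : {mpoly k[2]}, z = subst f g G) f g.

Definition succ1 (c : chart) : chart := adjoin (gen1 c) (gen2 c / gen1 c).
Definition succ2 (c : chart) : chart := adjoin (gen2 c) (gen1 c / gen2 c).

Inductive tree_vertex : chart -> Prop :=
| tree_root : tree_vertex (adjoin fx fy)
| tree_succ1 c : tree_vertex c -> tree_vertex (succ1 c)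
| tree_succ2 c : tree_vertex c -> tree_vertex (succ2 c).

Definition tree_edge (c d : chart) : Prop :=
  tree_vertex c /\ (d = succ1 c \/ d = succ2 c).

Definition valuation_tree : digraph chart := Digraph tree_vertex tree_edge.

Definition valuation_positive (nu : kxy -> option int) (c : chart) : Prop :=
  positive_value (nu (gen1 c)) /\ positive_value (nu (gen2 c)).

Definition P_nu (nu : kxy -> option int) : digraph chart :=
  induced_subgraph valuation_tree (valuation_positive nu).

(* The morphism from the chart to the [(x,y)]-plane is dual to the inclusion
   [k[x,y] <= k[f,g]], so the preimage of the curve [P = 0] is the curve
   [G = 0] in the [(f,g)]-plane, where [G(f, g) = P(x, y)] in [k(x,y)]. *)
Definition preimage_eqn (c : chart) (P G : {mpoly k[2]}) : Prop :=
  subst (gen1 c) (gen2 c) G = embed P.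

Definition preimage_not_resolved (P : {mpoly k[2]}) (c : chart) : Prop :=
  exists2 G : {mpoly k[2]}, preimage_eqn c P G & ~ resolved G.

Definition P_ab (a b : nat) : digraph chart :=
  induced_subgraph valuation_tree
    (preimage_not_resolved (polyx ^+ b - polyy ^+ a)).

End Tree.

(* Main.v *)
Require Import Defs.
From mathcomp Require Import all_boot all_order all_algebra.
From HB Require Import structures.
From mathcomp Require Import generic_quotient fraction mpoly.
From mathcomp Require Import ring zify.
From Stdlib Require Import FunctionalExtensionality PropExtensionality.

(** A vertex [k[f,g]] satisfies [x = f^m1 g^m2] and [y = f^n1 g^n2] with
   [m1 n2 - m2 n1 = e], [e^2 = 1].  Put [al = nu f] and [be = nu g].  The full
   preimage of [x^b = y^a] in the chart is the binomial
   [f^(b m1) g^(b m2) - f^(a n1) g^(a n2)], whose exponents differ by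
   [e (be, -al)].  Hence, up to sign, it is [f^p g^q (f^be - g^al)] when [al] and
   [be] are positive, and [f^p g^q (f^c g^d - 1)] with [c = |be|], [d = |al|]
   otherwise.  In the first case the origin is a singular point of the last
   factor if [al, be > 1], a tangency with an axis if exactly one of them is [1],
   and a triple point if both are [1].  In the second case Euler's relations show
   that the last factor is smooth and transverse to both axes.  Both last factors
   are irreducible because [al] and [be] are coprime. *)

Set Implicit Arguments.
Unset Strict Implicit.
Unset Printing Implicit Defensive.

Import GRing.Theory Num.Theory.
Local Open Scope ring_scope.

(** ** Polynomials in two variables *)

HB.instance Definition _ (k L : fieldType) (iota : {rmorphism k -> L}) (s t : L) :=
  GRing.RMorphism.copy (eval_at iota s t) (mmap iota (pair_fun s t)).

HB.instance Definition _ (k : fieldType) :=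
  GRing.RMorphism.copy (@embed k) (@FracField.tofrac {mpoly k[2]}).

HB.instance Definition _ (k : fieldType) (f g : kxy k) :=
  GRing.RMorphism.copy (subst f g)
    (mmap (@embed k \o @mpolyC 2 k) (pair_fun f g)).

Section Bivariate.
Variable k : fieldType.
Local Notation P := {mpoly k[2]}.
Local Notation X := (polyx k).
Local Notation Y := (polyy k).

Definition bimon (i j : nat) : 'X_{1..2} := [multinom pair_fun i j l | l < 2].

Lemma bimonK (m : 'X_{1..2}) : bimon (m ord0) (m ord_max) = m.
Proof.
apply/mnmP => i; rewrite mnmE /pair_fun; case: eqP => [->//|].
by case: i => [[|[|i]] //= lt_i2] ne_i0; [case: ne_i0|congr (m _)]; apply: val_inj.
Qed.

Lemma mpolyX2 (m : 'X_{1..2}) : 'X_[k, m] = X ^+ m ord0 * Y ^+ m ord_max.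
Proof.
rewrite [LHS]mpolyXE_id !big_ord_recl big_ord0 mulr1 /polyx /polyy.
by have -> : lift ord0 ord0 = ord_max :> 'I_2 by apply: val_inj.
Qed.

Lemma mpolyX_bimon i j : 'X_[k, bimon i j] = X ^+ i * Y ^+ j.
Proof. by rewrite mpolyX2 !mnmE. Qed.

Lemma eval_atX (L : fieldType) (iota : {rmorphism k -> L}) s t : eval_at iota s t X = s.
Proof. by rewrite /eval_at mmapX mmap1U. Qed.
Lemma eval_atY (L : fieldType) (iota : {rmorphism k -> L}) s t : eval_at iota s t Y = t.
Proof. by rewrite /eval_at mmapX mmap1U. Qed.

Lemma substX (f g : kxy k) : subst f g X = f.
Proof. by rewrite [LHS](mmapX (pair_fun f g) (@embed k \o @mpolyC 2 k)) mmap1U. Qed.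
Lemma substY (f g : kxy k) : subst f g Y = g.
Proof. by rewrite [LHS](mmapX (pair_fun f g) (@embed k \o @mpolyC 2 k)) mmap1U. Qed.

Lemma eval_at_unit (L : fieldType) (iota : {rmorphism k -> L}) s t (u : P) :
  u \is a GRing.unit -> eval_at iota s t u != 0.
Proof. by move=> /(rmorph_unit (eval_at iota s t)); rewrite unitfE. Qed.

Lemma substE (f g : kxy k) (D : P) :
  subst f g D =
  \sum_(m <- msupp D) embed (D@_m)%:MP * (f ^+ m ord0 * g ^+ m ord_max).
Proof.
apply: eq_bigr => m _; congr (_ * _); rewrite /mmap1 !big_ord_recl big_ord0 mulr1.
by have -> : lift ord0 ord0 = ord_max :> 'I_2 by apply: val_inj.
Qed.

Lemma subst_fxy (D : P) : subst (fx k) (fy k) D = embed D.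
Proof.
rewrite substE [in RHS](mpolyE D) rmorph_sum; apply: eq_bigr => m _.
by rewrite /= -mul_mpolyC rmorphM mpolyX2 rmorphM !rmorphXn.
Qed.

Lemma embed_inj : injective (@embed k).
Proof. by move=> p q /eqP; rewrite tofrac_eq => /eqP. Qed.

Lemma polyx_neq0 : X != 0.
Proof. by rewrite -msize_poly_eq0 msizeX mdeg1. Qed.

Lemma fx_neq0 : fx k != 0.
Proof. by rewrite tofrac_eq0 polyx_neq0. Qed.

(** * Algebraic independence and substitution of monomials *)

Definition alg_indep (f g : kxy k) : Prop :=
  forall D : P, subst f g D = 0 -> D = 0.

Lemma alg_indep_fxy : alg_indep (fx k) (fy k).
Proof.
by move=> D; rewrite subst_fxy => D0; apply: embed_inj; rewrite D0 rmorph0.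
Qed.

(** The factor [z] clears denominators: each monomial [m] of [D] at [(f, g)] becomes the monomial of
    exponent [h m] at [(f0, g0)]. As [h] is injective on the support no terms merge, so [D'] carries
    the coefficients of [D], and independence of [f0], [g0] kills them. *)
Lemma subst_monomial_eq0 (f0 g0 f g z : kxy k) (h : 'X_{1..2} -> 'X_{1..2})
    (D : P) :
    alg_indep f0 g0 ->
    {in msupp D, forall m : 'X_{1..2}, z * (f ^+ m ord0 * g ^+ m ord_max) =
                           f0 ^+ h m ord0 * g0 ^+ h m ord_max} ->
    {in msupp D &, injective h} ->
  subst f g D = 0 -> D = 0.
Proof.
move=> indep0 fgE h_inj D0.
pose D' := \sum_(m <- msupp D) D@_m *: 'X_[h m].
have D'0 : D' = 0.
  apply: indep0; rewrite -(mulr0 z) -D0 (substE f g D) rmorph_sum mulr_sumr /=.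
  apply: eq_big_seq => m /fgE E; rewrite [RHS]mulrCA E.
  rewrite -mul_mpolyC mpolyX2 !rmorphM !rmorphXn /= substX substY.
  by congr (_ * _); rewrite [LHS](mmapC (pair_fun f0 g0) (@embed k \o @mpolyC 2 k)).
apply: msuppnil0; case Esupp: (msupp D) => [//|m s].
have mD : m \in msupp D by rewrite Esupp mem_head.
have := mD; rewrite mcoeff_msupp => /eqP[]; rewrite -[RHS](mcoeff0 _ (h m)) -D'0.
rewrite raddf_sum (bigD1_seq m) ?msupp_uniq //= mcoeffZ mcoeffX eqxx mulr1.
rewrite big_seq_cond big1 ?addr0 // => n /andP[nD ne_nm].
rewrite mcoeffZ mcoeffX (_ : _ == _ = false) ?mulr0 //.
by apply: contra_neqF ne_nm => /eqP/h_inj->.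
Qed.

Definition iweight (al be : int) (m : 'X_{1..2}) : int :=
  al * (m ord0)%:Z + be * (m ord_max)%:Z.

(** The monomial [m] becomes the power of [x] with the possibly negative exponent [iweight al be m];
    distinct weights exclude cancellation. *)
Lemma subst_weight_eq0 (al be : int) (A : P) :
    {in msupp A &, injective (iweight al be)} ->
  subst (fx k ^ al) (fx k ^ be) A = 0 -> A = 0.
Proof.
(* [N] bounds every [|iweight al be m|], so a factor [x^N] makes all exponents nonnegative. *)
pose N := (\sum_(m <- msupp A) `|iweight al be m|)%N.
have leN m : m \in msupp A -> 0 <= N%:Z + iweight al be m.
  move=> mA; rewrite /N (bigD1_seq m) ?msupp_uniq //=; lia.
move=> w_inj.
apply: (@subst_monomial_eq0 _ _ _ _ (fx k ^ N%:Z)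
    (fun m => bimon (absz (N%:Z + iweight al be m)) 0) A alg_indep_fxy).
  move=> m /leN le0; rewrite !mnmE /pair_fun /= expr0 mulr1 !exprnP gez0_abs //.
  by rewrite !exprz_exp /iweight -!expfzDr ?fx_neq0.
move=> m n mA nA /mnmP/(_ ord0); rewrite !mnmE /pair_fun /= => E.
by apply: w_inj => //; have := leN _ mA; have := leN _ nA; lia.
Qed.

(** * Irreducibility of the two binomials *)

Lemma msize1_unit (p : P) : msize p = 1%N -> p \is a GRing.unit.
Proof.
move=> /eqP/msize_poly1P[c c0 ->].
by apply: (rmorph_unit (@mpolyC 2 k)); rewrite unitfE.
Qed.

(* A factor in the kernel of phi already has the degree of H, so the
   complementary factor is constant. *)
Lemma irreducible_of_kernel (phi : {rmorphism P -> kxy k}) (H : P) :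
    (1 < msize H)%N -> phi H = 0 ->
    (forall A, A != 0 -> phi A = 0 -> (msize H <= msize A)%N) ->
  irreducible_elt H.
Proof.
move=> H1 phiH minH.
have H0 : H != 0 by rewrite -msize_poly_eq0; case: (msize H) H1.
have cofactor A B : H = A * B -> phi A = 0 -> B \is a GRing.unit.
  move=> HE A0; have := H0; rewrite HE mulf_eq0 negb_or => /andP[nzA nzB].
  have := minH _ nzA A0; rewrite HE msizeM // => le.
  apply: msize1_unit; move: nzA nzB le; rewrite -!msize_poly_eq0.
  by case: (msize A) (msize B) => [|i] [|j] //= _ _; lia.
split=> //.
  apply: contraTN H1 => /andP[/eqP-> _]; rewrite msizeC; lia.
move=> A B HE; have /eqP := phiH; rewrite HE rmorphM mulf_eq0.
case/orP => /eqP ?; last by left; apply: (cofactor B); rewrite // mulrC.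
by right; apply: (cofactor A).
Qed.

End Bivariate.

(** By coprimality [be] divides [i - i'] and [al] divides [j' - j]. For [i' <= i] and nonzero
    differences this gives [i >= be] and [j' >= al], so one of the two degrees reaches
    [maxn al be]. *)
Lemma coprime_weight_inj al be i j i' j' :
    (0 < al)%N -> (0 < be)%N -> coprime al be ->
    (al * i + be * j = al * i' + be * j')%N ->
    (i + j < maxn al be)%N -> (i' + j' < maxn al be)%N ->
  i = i' /\ j = j'.
Proof.
move=> al0 be0 co; wlog le_i : i j i' j' / (i' <= i)%N => [WH|] E lt lt'.
  have [le|/ltnW le] := leqP i' i; first exact: WH.
  by case: (WH i' j' i j le (esym E) lt' lt).
have E' : (al * (i - i') = be * (j' - j))%N by nia.
have be_dvd : (be %| i - i')%N.
  by rewrite -(@Gauss_dvdr _ al) 1?coprime_sym // E' dvdn_mulr.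
have al_dvd : (al %| j' - j)%N by rewrite -(@Gauss_dvdr _ be) // -E' dvdn_mulr.
have [i0|i_gt0] := posnP (i - i').
  by split; nia.
have j_gt0 : (0 < j' - j)%N by nia.
have := dvdn_leq i_gt0 be_dvd; have := dvdn_leq j_gt0 al_dvd; lia.
Qed.

(** The weight is now [d i - c j], so [i - i'] and [j - j'] have the same sign. For [i' <= i] and
    nonzero differences, [i >= c] and [j >= d], against the degree bound. *)
Lemma coprime_hyperbolic_weight_inj c d i j i' j' :
    coprime c d ->
    (d * i + c * j' = d * i' + c * j)%N ->
    (i + j < c + d)%N -> (i' + j' < c + d)%N ->
  i = i' /\ j = j'.
Proof.
move=> co; have [c0|c_gt0] := posnP c.
  by have := co; rewrite c0 /coprime gcd0n => /eqP->; lia.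
have [d0|d_gt0] := posnP d.
  by have := co; rewrite d0 /coprime gcdn0 => /eqP->; lia.
wlog le_i : i j i' j' / (i' <= i)%N => [WH|] E lt lt'.
  have [le|/ltnW le] := leqP i' i; first exact: WH.
  by case: (WH i' j' i j le (esym E) lt' lt).
have E' : (d * (i - i') = c * (j - j'))%N by nia.
have c_dvd : (c %| i - i')%N by rewrite -(@Gauss_dvdr _ d) // E' dvdn_mulr.
have d_dvd : (d %| j - j')%N.
  by rewrite -(@Gauss_dvdr _ c) 1?coprime_sym // -E' dvdn_mulr.
have [i0|i_gt0] := posnP (i - i').
  by split; nia.
have j_gt0 : (0 < j - j')%N by nia.
have := dvdn_leq i_gt0 c_dvd; have := dvdn_leq j_gt0 d_dvd; lia.
Qed.

Section Curves.
Variable k : fieldType.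
Local Notation P := {mpoly k[2]}.
Local Notation X := (polyx k).
Local Notation Y := (polyy k).

Lemma mdeg2 (m : 'X_{1..2}) : mdeg m = (m ord0 + m ord_max)%N.
Proof.
rewrite mdegE !big_ord_recl big_ord0 addn0.
by have -> : lift ord0 ord0 = ord_max :> 'I_2 by apply: val_inj.
Qed.

Lemma mnm2P (m n : 'X_{1..2}) : m ord0 = n ord0 -> m ord_max = n ord_max -> m = n.
Proof. by move=> E0 E1; rewrite -[m]bimonK -[n]bimonK E0 E1. Qed.

(** The curve is parametrized by [(x^al, x^be)]. Below degree [maxn al be] the monomials have
    distinct weights, so no nonzero polynomial of smaller degree vanishes on the parametrization. *)
Lemma irreducible_cusp al be : (0 < al)%N -> (0 < be)%N -> coprime al be ->
  irreducible_elt (X ^+ be - Y ^+ al).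
Proof.
move=> al0 be0 co.
have msize_le : (msize (X ^+ be - Y ^+ al) <= (maxn al be).+1)%N.
  rewrite (leq_trans (msizeD_le _ _)) // msizeN !mpolyXn !msizeX !mdegMn !mdeg1.
  lia.
apply: (@irreducible_of_kernel _ (subst (fx k ^ al%:Z) (fx k ^ be%:Z))).
- have : (be.+1 <= msize (X ^+ be - Y ^+ al))%N.
    have : (U_(ord0) *+ be)%MM \in msupp (X ^+ be - Y ^+ al).
      rewrite mcoeff_msupp mcoeffB !mpolyXn !mcoeffX eqxx.
      rewrite (_ : (_ *+ al == _)%MM = false) ?subr0 ?oner_eq0 //.
      apply/negbTE/eqP => /mnmP/(_ ord0); rewrite !mulmnE !mnm1E /=; lia.
    by move/msize_mdeg_lt; rewrite mdegMn mdeg1 mul1n.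
  lia.
- by rewrite rmorphB !rmorphXn /= substX substY !exprnP !exprz_exp mulrC subrr.
move=> A nzA A0; rewrite leqNgt; apply/negP => ltA; move/eqP: nzA; apply.
apply: subst_weight_eq0 A0 => m n mA nA; rewrite /iweight => E.
have {mA} := leq_trans (msize_mdeg_lt mA) (leq_trans ltA msize_le).
have {nA} := leq_trans (msize_mdeg_lt nA) (leq_trans ltA msize_le).
rewrite !mdeg2 => lt_n lt_m.
have [] : m ord0 = n ord0 /\ m ord_max = n ord_max; last exact: mnm2P.
apply: (coprime_weight_inj al0 be0 co) lt_m lt_n; lia.
Qed.

(** The parametrization is [(x^d, x^(-c))], with weights [d i - c j] distinct below degree [c + d].
    Coprimality excludes [c = d = 0]. *)
Lemma irreducible_hyperbola c d : coprime c d ->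
  irreducible_elt (X ^+ c * Y ^+ d - 1).
Proof.
move=> co.
have cd0 : (0 < c + d)%N.
  by move: co; case: c d => [|c] [|d] //; rewrite ?addn0.
have msize_le : (msize (X ^+ c * Y ^+ d - 1) <= (c + d).+1)%N.
  rewrite (leq_trans (msizeD_le _ _)) // msizeN msize1 -mpolyX_bimon msizeX.
  by rewrite mdeg2 !mnmE geq_max leqnn.
apply: (@irreducible_of_kernel _ (subst (fx k ^ d%:Z) (fx k ^ (- c%:Z)))).
- have : ((c + d).+1 <= msize (X ^+ c * Y ^+ d - 1))%N.
    have : bimon c d \in msupp (X ^+ c * Y ^+ d - 1).
      rewrite mcoeff_msupp mcoeffB -mpolyX_bimon mcoeffX eqxx mcoeff1 -mdeg_eq0.
      by rewrite mdeg2 !mnmE /pair_fun /= eqn0Ngt cd0 subr0 oner_eq0.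
    by move/msize_mdeg_lt; rewrite mdeg2 !mnmE.
  lia.
- rewrite rmorphB rmorphM !rmorphXn rmorph1 /= substX substY !exprnP !exprz_exp.
  by rewrite -expfzDr ?fx_neq0 // mulNr mulrC subrr expr0z subrr.
move=> A nzA A0; rewrite leqNgt; apply/negP => ltA; move/eqP: nzA; apply.
apply: subst_weight_eq0 A0 => m n mA nA; rewrite /iweight => E.
have {mA} := leq_trans (msize_mdeg_lt mA) (leq_trans ltA msize_le).
have {nA} := leq_trans (msize_mdeg_lt nA) (leq_trans ltA msize_le).
rewrite !mdeg2 => lt_n lt_m.
have [] : m ord0 = n ord0 /\ m ord_max = n ord_max; last exact: mnm2P.
apply: (coprime_hyperbolic_weight_inj co) lt_m lt_n; lia.
Qed.

End Curves.

(** ** Local study of the preimage curves *)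

Section Primes.
Variable R : idomainType.
Implicit Types p q r : R.

Definition prime_elt p : Prop :=
  [/\ p != 0, p \isn't a GRing.unit &
      forall q r s, q * r = p * s ->
        (exists q', q = p * q') \/ (exists r', r = p * r')].

Lemma prime_irreducible p : prime_elt p -> irreducible_elt p.
Proof.
move=> [p0 pNu p_prime]; split=> // q r qr.
have [|[q' q'E]|[r' r'E]] := p_prime q r 1; first by rewrite mulr1.
- right; apply/unitrPr; exists q'; apply: (mulfI p0).
  by rewrite {2}qr q'E; ring.
- left; apply/unitrPr; exists r'; apply: (mulfI p0).
  by rewrite {2}qr r'E; ring.
Qed.

Lemma irreducible_associated p q r : irreducible_elt p ->
  irreducible_elt q -> p = q * r -> associated q p.
Proof.
move=> [_ _ p_irr] [_ qNu _] pE.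
by case: (p_irr _ _ pE) => [/(negP qNu)//|ru]; exists r; rewrite // mulrC.
Qed.

Lemma associated_sym p q : associated p q -> associated q p.
Proof. by case=> u uu ->; exists u^-1; rewrite ?unitrV // mulKr. Qed.

Lemma associated_trans p q r : associated p q -> associated q r -> associated p r.
Proof.
by case=> u uu -> [v vu ->]; exists (v * u); rewrite ?unitrMl // mulrA.
Qed.

(** Factors [p] are peeled off one at a time: either [p] divides [f], which makes them associated,
    or it divides the cofactor [r] and cancels. *)
Lemma irreducible_dvd_prime_pow p n f r s : prime_elt p -> irreducible_elt f ->
  p ^+ n * s = f * r -> associated p f \/ exists r', s = f * r'.
Proof.
move=> pP fI; elim: n s r => [|n IHn] s r E.
  by right; exists r; rewrite -E mul1r.
have [_ _ p_prime] := pP.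
have [|[f' f'E]|[r' r'E]] := p_prime f r (p ^+ n * s).
- by rewrite -E exprS mulrA.
- by left; apply: irreducible_associated f'E => //; apply: prime_irreducible.
apply: (IHn s r'); have [p0 _ _] := pP; apply: (mulfI p0).
by rewrite mulrA -exprS E r'E mulrCA.
Qed.

End Primes.

Section Curves.
Variable k : fieldType.
Local Notation P := {mpoly k[2]}.
Local Notation X := (polyx k).
Local Notation Y := (polyy k).

(** [psi] sets the variable ['X_i] to zero. Every polynomial is congruent to its image modulo
    ['X_i], so a kernel element is a multiple of ['X_i], and the target of [psi] is a domain. *)
Lemma prime_var (i : 'I_2) : prime_elt ('X_i : P).
Proof.
pose h (j : 'I_2) : P := if j == i then 0 else 'X_j.
have [psi psiX psiC] : exists2 psi : {rmorphism P -> P},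
    forall j, psi 'X_j = h j & forall c, psi c%:MP = c%:MP.
  exists (mmap (@mpolyC 2 k) h) => [j|c]; last by rewrite /= mmapC.
  by rewrite /= mmapX mmap1U.
have psiE (p : P) : exists q, p = psi p + 'X_i * q.
  have psiXn j n : exists q, 'X_j ^+ n = psi ('X_j ^+ n) + 'X_i * q.
    rewrite rmorphXn psiX /h; have [->|_] := eqVneq j i.
      case: n => [|n]; first by exists 0; rewrite !expr0 mulr0 addr0.
      by exists ('X_i ^+ n); rewrite expr0n add0r exprS.
    by exists 0; rewrite mulr0 addr0.
  elim/mpolyind: p => [|c m p _ _ [q pE]].
    by exists 0; rewrite rmorph0 mulr0 addr0.
  have [q1 E1] := psiXn ord0 (m ord0); have [q2 E2] := psiXn ord_max (m ord_max).
  rewrite -mul_mpolyC mpolyX2 rmorphD !rmorphM psiC.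
  move: (psi p) pE E1 E2 => psip ->; rewrite /polyx /polyy.
  move: (_ ^+ m ord0) (_ ^+ m ord_max) => A B; move: (psi A) (psi B) => psiA psiB -> ->.
  exists (c%:MP * (psiA * q2 + psiB * q1 + 'X_i * q1 * q2) + q); ring.
have Xi0 : 'X_i != 0 :> P by rewrite -msize_poly_eq0 msizeX mdeg1.
split=> //.
  apply/negP => /(rmorph_unit psi); rewrite psiX /h eqxx unitr0 //.
move=> q r s E.
have /eqP : psi (q * r) = 0 by rewrite E rmorphM psiX /h eqxx mul0r.
rewrite rmorphM mulf_eq0; have [q' qE] := psiE q; have [r' rE] := psiE r.
case/orP => /eqP E0; [left; exists q'|right; exists r'].
  by rewrite qE E0 add0r.
by rewrite rE E0 add0r.
Qed.

Lemma mderivXn i (p : P) n : mderiv i (p ^+ n) = n%:R * p ^+ n.-1 * mderiv i p.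
Proof.
elim: n => [|n IHn]; first by rewrite expr0 mul0r mul0r -mpolyC1 mderivC.
rewrite exprS mderivM IHn; case: n {IHn} => [|n]; first by rewrite !expr0; ring.
by rewrite /= -[n.+2]addn1 natrD exprS; ring.
Qed.

Lemma mderivXi (i j : 'I_2) : mderiv i ('X_j : P) = (i == j)%:R.
Proof.
rewrite mderivX mnm1E eq_sym; case: eqP => [->|_]; last by rewrite scale0r.
have -> : (U_(j) - U_(j) = 0 :> 'X_{1..2})%MM.
  by apply/mnmP => l; rewrite mnmBE subnn mnm0E.
by rewrite mpolyX0 scale1r.
Qed.

Lemma mderiv1 i : mderiv i (1 : P) = 0.
Proof. by rewrite -mpolyC1 mderivC. Qed.

Definition mderivE := (mderivB, mderivM, mderivXn, mderiv1).

Section Points.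
Variables (L : fieldType) (iota : {rmorphism k -> L}) (s t : L).
Local Notation ev := (eval_at iota s t).

(** At a point of [F = 0] the product rule loses the term containing [F], so the factor [u] only
    scales the gradient. For a unit the scale is nonzero, and singularity and tangency do not depend
    on the equation chosen for a component. *)
Lemma du_mul_on_curve u F : on_curve iota s t F ->
  du iota s t (u * F) = ev u * du iota s t F.
Proof.
by rewrite /on_curve /du mderivM rmorphD !rmorphM /= => ->; rewrite mulr0 add0r.
Qed.

Lemma dv_mul_on_curve u F : on_curve iota s t F ->
  dv iota s t (u * F) = ev u * dv iota s t F.
Proof.
by rewrite /on_curve /dv mderivM rmorphD !rmorphM /= => ->; rewrite mulr0 add0r.
Qed.

Lemma on_curve_associated F F' :
  associated F F' -> on_curve iota s t F' -> on_curve iota s t F.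
Proof.
move=> [u uu ->]; rewrite /on_curve rmorphM => /eqP.
by rewrite mulf_eq0 (negbTE (eval_at_unit _ _ _ uu)) => /eqP.
Qed.

Lemma singular_at_associated F F' :
  associated F F' -> singular_at iota s t F' -> singular_at iota s t F.
Proof.
move=> aF [cF']; have cF := on_curve_associated aF cF'; case: aF => u uu ->.
have u0 := eval_at_unit iota s t uu.
rewrite du_mul_on_curve // dv_mul_on_curve // => /eqP + /eqP.
by rewrite !mulf_eq0 (negbTE u0) => /eqP ? /eqP ?.
Qed.

Lemma tangent_space_associated F F' l m : associated F F' -> on_curve iota s t F ->
  tangent_space iota s t F l m <-> tangent_space iota s t F' l m.
Proof.
move=> [u uu ->] cF; rewrite /tangent_space du_mul_on_curve // dv_mul_on_curve //.
have u0 := eval_at_unit iota s t uu.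
rewrite -!mulrA -mulrDr; split=> [->|/eqP]; first by rewrite mulr0.
by rewrite mulf_eq0 (negbTE u0) => /eqP.
Qed.

Lemma not_associated F F' :
  on_curve iota s t F' -> ~ on_curve iota s t F -> ~ associated F F'.
Proof. by move=> cF' nF /on_curve_associated aF; apply/nF/aF. Qed.

End Points.

Lemma component_opp (G F : P) : component (- G) F <-> component G F.
Proof.
split=> -[FI [H E]]; split=> //; exists (- H).
  by rewrite mulrN -E opprK.
by rewrite mulrN -E.
Qed.

(** Opposite polynomials have the same components; this absorbs the signs met when the binomials are
    factored. *)
Lemma resolved_opp (G : P) : resolved (- G) <-> resolved G.
Proof.
suff imp (G' : P) : resolved G' -> resolved (- G').
  by split=> /imp; rewrite ?opprK.
move=> [sm [tr tg]]; split; last split.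
- by move=> F /component_opp/sm.
- by move=> F1 F2 F3 /component_opp c1 /component_opp c2 /component_opp c3; apply: tr.
- by move=> F1 F2 /component_opp c1 /component_opp c2; apply: tg.
Qed.

End Curves.

(** * Gradients of the binomials, and the cusp with the axes *)

Section Curves.
Variable k : fieldType.
Local Notation P := {mpoly k[2]}.
Local Notation X := (polyx k).
Local Notation Y := (polyy k).

Lemma mderiv_xy :
  ((mderiv ord0 X = 1) * (mderiv ord_max X = 0)) *
  ((mderiv ord0 Y = 0) * (mderiv ord_max Y = 1)).
Proof. by rewrite !mderivXi. Qed.

Section Points.
Variables (L : fieldType) (iota : {rmorphism k -> L}) (s t : L).

Lemma du_monomial_sub (F : P) i j : 
  du iota s t (X ^+ i * Y ^+ j - F) = i%:R * s ^+ i.-1 * t ^+ j - du iota s t F.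
Proof.
rewrite /du !mderivE !mderiv_xy mulr0 mulr0 addr0 mulr1.
by rewrite rmorphB !rmorphM !rmorphXn rmorph_nat /= eval_atX eval_atY.
Qed.

Lemma dv_monomial_sub (F : P) i j : 
  dv iota s t (X ^+ i * Y ^+ j - F) = s ^+ i * (j%:R * t ^+ j.-1) - dv iota s t F.
Proof.
rewrite /dv !mderivE !mderiv_xy mulr0 mul0r add0r mulr1.
by rewrite rmorphB !rmorphM !rmorphXn rmorph_nat /= eval_atX eval_atY.
Qed.

Lemma du1 : du iota s t 1 = 0. Proof. by rewrite /du mderiv1 rmorph0. Qed.
Lemma dv1 : dv iota s t 1 = 0. Proof. by rewrite /dv mderiv1 rmorph0. Qed.

Lemma duX : du iota s t X = 1. Proof. by rewrite /du mderiv_xy rmorph1. Qed.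
Lemma dvX : dv iota s t X = 0. Proof. by rewrite /dv mderiv_xy rmorph0. Qed.
Lemma duY : du iota s t Y = 0. Proof. by rewrite /du mderiv_xy rmorph0. Qed.
Lemma dvY : dv iota s t Y = 1. Proof. by rewrite /dv mderiv_xy rmorph1. Qed.

Lemma du_cusp be al :
  du iota s t (X ^+ be - Y ^+ al) = be%:R * s ^+ be.-1.
Proof.
rewrite /du !mderivE !mderiv_xy mulr0 subr0 mulr1.
by rewrite rmorphM rmorphXn rmorph_nat /= eval_atX.
Qed.

Lemma dv_cusp be al :
  dv iota s t (X ^+ be - Y ^+ al) = - (al%:R * t ^+ al.-1).
Proof.
rewrite /dv !mderivE !mderiv_xy mulr0 mulr1 sub0r.
by rewrite rmorphN rmorphM rmorphXn rmorph_nat /= eval_atY.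
Qed.

Lemma on_curve_cusp be al :
  on_curve iota s t (X ^+ be - Y ^+ al) <-> s ^+ be = t ^+ al.
Proof.
rewrite /on_curve rmorphB !rmorphXn /= eval_atX eval_atY.
by split=> [/eqP|->]; rewrite ?subrr // subr_eq0 => /eqP.
Qed.

Lemma on_curve_hyperbola c d :
  on_curve iota s t (X ^+ c * Y ^+ d - 1) <-> s ^+ c * t ^+ d = 1.
Proof.
rewrite /on_curve rmorphB rmorphM !rmorphXn rmorph1 /= eval_atX eval_atY.
by split=> [/eqP|->]; rewrite ?subrr // subr_eq0 => /eqP.
Qed.

Lemma on_curveX : on_curve iota s t X <-> s = 0.
Proof. by rewrite /on_curve eval_atX. Qed.
Lemma on_curveY : on_curve iota s t Y <-> t = 0.
Proof. by rewrite /on_curve eval_atY. Qed.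

End Points.

Lemma not_associated_xy : ~ associated X Y.
Proof.
apply: (@not_associated _ _ idfun 1 0); first exact/on_curveY.
by rewrite on_curveX; apply/eqP/oner_neq0.
Qed.

Lemma expr0_pos (R : pzRingType) n : (0 < n)%N -> 0 ^+ n = 0 :> R.
Proof. by rewrite expr0n; case: n. Qed.

Lemma not_associated_x_cusp be al : (0 < be)%N -> ~ associated X (X ^+ be - Y ^+ al).
Proof.
move=> be0 /associated_sym; apply: (@not_associated _ _ idfun 0 1).
  exact/on_curveX.
by rewrite on_curve_cusp expr1n expr0_pos // => /esym/eqP; rewrite oner_eq0.
Qed.

Lemma not_associated_y_cusp be al : (0 < al)%N -> ~ associated Y (X ^+ be - Y ^+ al).
Proof.
move=> al0 /associated_sym; apply: (@not_associated _ _ idfun 1 0).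
  exact/on_curveY.
by rewrite on_curve_cusp expr1n expr0_pos // => /eqP; rewrite oner_eq0.
Qed.

(** The bad point is always the origin, which is rational over [k]. When [al] or [be] is 1 the last
    factor is smooth, and the defect comes from an axis; the conditions on [p] and [q] ensure that
    this axis is a component. *)
Lemma cusp_not_resolved p q al be :
    (0 < al)%N -> (0 < be)%N -> coprime al be ->
    (al = 1%N -> (0 < q)%N) -> (be = 1%N -> (0 < p)%N) ->
  ~ resolved (X ^+ p * Y ^+ q * (X ^+ be - Y ^+ al)).
Proof.
move=> al0 be0 co q0 p0; set H := X ^+ be - Y ^+ al; set G := _ * H.
move=> [smooth [no3 notan]].
have cH : component G H.
  by split; [exact: irreducible_cusp|exists (X ^+ p * Y ^+ q); rewrite /G mulrC].
have cX : (0 < p)%N -> component G X.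
  move=> p_gt0; split; first exact/prime_irreducible/prime_var.
  by exists (X ^+ p.-1 * Y ^+ q * H); rewrite /G -{1}(prednK p_gt0) exprS; ring.
have cY : (0 < q)%N -> component G Y.
  move=> q_gt0; split; first exact/prime_irreducible/prime_var.
  by exists (X ^+ p * Y ^+ q.-1 * H); rewrite /G -{1}(prednK q_gt0) exprS; ring.
have nXH : ~ associated X H by apply: not_associated_x_cusp.
have nYH : ~ associated Y H by apply: not_associated_y_cusp.
have OH : on_curve (idfun : k -> k) 0 0 H by apply/on_curve_cusp; rewrite !expr0_pos.
have OX : on_curve (idfun : k -> k) 0 0 X by apply/on_curveX.
have OY : on_curve (idfun : k -> k) 0 0 Y by apply/on_curveY.
(* For [al > 1] the second partial derivative vanishes at the origin: the curve is singular there if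
   [be > 1], and tangent to [X = 0] if [be = 1]. *)
have [al1|al_neq1] := eqVneq al 1%N; last first.
  have dvH : dv (idfun : k -> k) 0 0 H = 0.
    by rewrite dv_cusp expr0_pos ?mulr0 ?oppr0 //; lia.
  have [be1|be_neq1] := eqVneq be 1%N; last first.
    apply: (smooth _ cH k idfun 0 0); split=> //.
    by rewrite du_cusp expr0_pos ?mulr0 //; lia.
  apply: (notan _ _ (cX (p0 be1)) cH nXH k idfun 0 0); split=> // l m.
  by rewrite /tangent_space dvH duX dvX du_cusp be1 expr0 mulr1.
have {q0}q0 := q0 al1.
have [be1|be_neq1] := eqVneq be 1%N.
  apply: (no3 _ _ _ (cX (p0 be1)) (cY q0) cH not_associated_xy nXH nYH k idfun 0 0).
  by split.
(* Here [al = 1 < be], and the tangent at the origin is the axis [Y = 0]. *)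
apply: (notan _ _ (cY q0) cH nYH k idfun 0 0); split=> // l m.
rewrite /tangent_space duY dvY du_cusp dv_cusp al1 expr0 expr0_pos; last lia.
rewrite mulr0 !mul0r !add0r !mulr1 mulNr.
by split=> [->|/eqP]; rewrite ?oppr0 // oppr_eq0 => /eqP.
Qed.

(** By Bezout, 1 is an integral combination of [c] and [d], so the characteristic of [L] cannot
    divide both. *)
Lemma coprime_natr_neq0 (L : fieldType) c d : coprime c d ->
  (c%:R = 0 :> L) -> (d%:R = 0 :> L) -> False.
Proof.
move=> co c0 d0; case: (posnP c) => [c_eq0|c_gt0].
  move: co d0; rewrite c_eq0 /coprime gcd0n => /eqP-> /eqP; by rewrite oner_eq0.
case: (egcdnP d c_gt0) => u v E _; have := congr1 (fun n => n%:R : L) E.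
rewrite natrD !natrM c0 d0 (eqP co) !mulr0 add0r => /esym/eqP.
by rewrite oner_eq0.
Qed.

(** The primes [X] and [Y] are stripped in turn; what remains is irreducible. *)
Lemma hyperbola_component p q c d F : coprime c d ->
  component (X ^+ p * Y ^+ q * (X ^+ c * Y ^+ d - 1)) F ->
  [\/ associated X F, associated Y F | associated (X ^+ c * Y ^+ d - 1) F].
Proof.
move=> co [FI [K]]; rewrite -mulrA => E.
have [|[K1]] := irreducible_dvd_prime_pow (prime_var k ord0) FI E.
  by constructor 1.
move=> {}E; have [|[K2 {}E]] := irreducible_dvd_prime_pow (prime_var k ord_max) FI E.
  by constructor 2.
constructor 3; apply: associated_sym; apply: irreducible_associated E => //.
exact: irreducible_hyperbola.
Qed.

(** * The hyperbola together with the axes *)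

Section Hyperbola.
Variables (c d : nat).
Hypothesis co : coprime c d.
Local Notation H := (X ^+ c * Y ^+ d - 1).

Section Points.
Variables (L : fieldType) (iota : {rmorphism k -> L}) (s t : L).

(* Euler's relations [s dH/du = c s^c t^d] and [t dH/dv = d s^c t^d]. *)
Lemma euler_hyperbola : on_curve iota s t H ->
  (c%:R = s * du iota s t H) /\ (d%:R = t * dv iota s t H).
Proof.
move=> /on_curve_hyperbola E; rewrite du_monomial_sub dv_monomial_sub du1 dv1.
rewrite !subr0; split.
  case: c E => [|c'] E; first by rewrite !mul0r mulr0.
  by rewrite -[LHS]mulr1 -E exprS; ring.
case: d E => [|d'] E; first by rewrite !(mul0r, mulr0).
by rewrite -[LHS]mulr1 -E exprS; ring.
Qed.

Lemma hyperbola_smooth : ~ singular_at iota s t H.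
Proof.
move=> [/euler_hyperbola[cE dE] du0 dv0].
by apply: (@coprime_natr_neq0 L c d); rewrite // (cE, dE) (du0, dv0) mulr0.
Qed.

(** The tangent line of [X = 0] is spanned by [(0, 1)], so tangency gives [dv H = 0]. Together with
    [s = 0], Euler's relations then yield [c = d = 0] in [L]. *)
Lemma hyperbola_transverse_x : ~ tangent_at iota s t X H.
Proof.
move=> [/on_curveX s0 cH T]; have [cE dE] := euler_hyperbola cH.
have /T : tangent_space iota s t X 0 1 by rewrite /tangent_space dvX mul0r mulr0 addr0.
rewrite /tangent_space mulr0 add0r mulr1 => dv0.
by apply: (@coprime_natr_neq0 L c d); rewrite // (cE, dE) (s0, dv0) (mul0r, mulr0).
Qed.

Lemma hyperbola_transverse_y : ~ tangent_at iota s t Y H.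
Proof.
move=> [/on_curveY t0 cH T]; have [cE dE] := euler_hyperbola cH.
have /T : tangent_space iota s t Y 1 0 by rewrite /tangent_space duY mul0r mulr0 addr0.
rewrite /tangent_space mulr0 addr0 mulr1 => du0.
by apply: (@coprime_natr_neq0 L c d); rewrite // (cE, dE) (t0, du0) (mul0r, mulr0).
Qed.

Lemma axes_transverse : ~ tangent_at iota s t X Y.
Proof.
move=> [_ _ /(_ 0 1)]; rewrite /tangent_space duX dvX duY dvY.
by rewrite !(mul0r, mulr0, mulr1, addr0, add0r) => -[/(_ erefl)/eqP]; rewrite oner_eq0.
Qed.

Lemma no_point_on_axes_and_hyperbola :
  on_curve iota s t X -> on_curve iota s t Y -> ~ on_curve iota s t H.
Proof.
move=> /on_curveX s0 /on_curveY t0 /euler_hyperbola[].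
rewrite s0 t0 !mul0r; exact: coprime_natr_neq0.
Qed.

Lemma tangent_at_associated F1 F2 G1 G2 :
  associated F1 G1 -> associated F2 G2 ->
  tangent_at iota s t G1 G2 -> tangent_at iota s t F1 F2.
Proof.
move=> a1 a2 [c1 c2 T].
have c1' := on_curve_associated a1 c1; have c2' := on_curve_associated a2 c2.
split=> // l m.
rewrite (tangent_space_associated _ _ a1 c1') (tangent_space_associated _ _ a2 c2').
exact: T.
Qed.

Lemma tangent_at_sym F1 F2 : tangent_at iota s t F1 F2 -> tangent_at iota s t F2 F1.
Proof. by move=> [c1 c2 T]; split=> // l m; split=> /T. Qed.

End Points.

Lemma hyperbola_resolved p q : resolved (X ^+ p * Y ^+ q * H).
Proof.
have assoc2 (E F1 F2 : P) : associated E F1 -> associated E F2 -> associated F1 F2.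
  by move=> /associated_sym; apply: associated_trans.
split.
  move=> F /(hyperbola_component co)[] aF L iota s t /(singular_at_associated aF).
  - by rewrite /singular_at duX => -[_ /eqP]; rewrite oner_eq0.
  - by rewrite /singular_at dvY => -[_ _ /eqP]; rewrite oner_eq0.
  exact: hyperbola_smooth.
split.
  move=> F1 F2 F3 /(hyperbola_component co) c1 /(hyperbola_component co) c2
    /(hyperbola_component co) c3 n12 n13 n23 L iota s t [].
  case: c1 => a1 /(on_curve_associated a1) O1;
  case: c2 => a2 /(on_curve_associated a2) O2;
  case: c3 => a3 /(on_curve_associated a3) O3;
  (* Three pairwise non-associated components must be the two axes and the hyperbola in some order;
     any other choice repeats a component. *)
  first [ by case: n12; apply: assoc2 a1 a2 | by case: n13; apply: assoc2 a1 a3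
        | by case: n23; apply: assoc2 a2 a3
        | by apply: (@no_point_on_axes_and_hyperbola L iota s t)].
move=> F1 F2 /(hyperbola_component co) c1 /(hyperbola_component co) c2 n12 L iota s t.
case: c1 => a1; case: c2 => a2 /(tangent_at_associated a1 a2);
  first [ by move=> _; apply: n12; apply: assoc2 a1 a2
        | by move=> /axes_transverse
        | by move=> /hyperbola_transverse_x
        | by move=> /hyperbola_transverse_y
        | by move=> /tangent_at_sym/axes_transverse
        | by move=> /tangent_at_sym/hyperbola_transverse_x
        | by move=> /tangent_at_sym/hyperbola_transverse_y].
Qed.

End Hyperbola.
End Curves.

(** ** The tree *)

Lemma blowup_monomial (F : fieldType) (f g : F) i j : f != 0 ->
  f ^+ (i + j) * (g / f) ^+ j = f ^+ i * g ^+ j.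
Proof.
by move=> f0; rewrite exprD expr_div_n -mulrA [X in _ * X]mulrC divfK ?expf_neq0.
Qed.

(** [minn] has no neutral element on [nat]; a commutative semigroup suffices to reorder a minimum
    with a given default value. *)
HB.instance Definition _ := SemiGroup.isComLaw.Build nat minn minnA minnC.

(** * Values of Laurent monomials *)

Section Valuation.
Variables (k : fieldType) (a b : nat).
Local Notation P := {mpoly k[2]}.

Lemma weightD m1 m2 :
  weight a b (m1 + m2)%MM = (weight a b m1 + weight a b m2)%N.
Proof. by rewrite /weight !mnmDE; nia. Qed.

(** Multiplication by a monomial translates the support, and also the leading monomial that serves
    as default value. *)
Lemma min_weightMX (p : P) m : p != 0 ->
  min_weight a b (p * 'X_[m]) = (min_weight a b p + weight a b m)%N.
Proof.
move=> p0; rewrite /min_weight mleadM //; last by rewrite -msize_poly_eq0 msizeX.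
rewrite mleadXm (perm_big _ (msuppMX p m)) big_map weightD.
rewrite [RHS](big_morph (fun n => n + weight a b m)%N
  (fun x y => addn_minl x y (weight a b m)) erefl).
by apply: eq_bigr => i _; rewrite weightD addnC.
Qed.

Lemma embed_repr_num (z : kxy k) :
  embed (frac (repr z)).1 = z * embed (frac (repr z)).2.
Proof.
rewrite -[X in X * _]reprK; move: (repr z) => r.
rewrite /embed; unlock FracField.tofrac; rewrite -[RHS]FracField.pi_mul.
apply/eqmodP; rewrite /= FracField.equivfE /FracField.mulf.
rewrite !numden_Ratio ?mulf_neq0 ?oner_eq0 ?denom_ratioP //.
by rewrite mulr1 mul1r.
Qed.

(** [z] is the quotient of the monomials [m] and [m'], written without division and not necessarily
    reduced; [n] is its value. *)
Definition laurent_monomial (z : kxy k) (n : int) : Prop :=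
  exists m m' : 'X_{1..2},
    z * embed 'X_[m'] = embed 'X_[m] /\ n = (weight a b m)%:Z - (weight a b m')%:Z.

Lemma embedX_neq0 m : embed 'X_[k, m] != 0.
Proof. by rewrite tofrac_eq0 -msize_poly_eq0 msizeX. Qed.

Lemma laurent_neq0 z n : laurent_monomial z n -> z != 0.
Proof.
by case=> m [m' [zE _]]; apply: contra_neq (embedX_neq0 m) => z0; rewrite -zE z0 mul0r.
Qed.

Lemma laurent_div z n z' n' :
  laurent_monomial z n -> laurent_monomial z' n' -> laurent_monomial (z / z') (n - n').
Proof.
move=> lz lz'; have z'0 := laurent_neq0 lz'.
case: lz lz' => m1 [m1' [E1 ->]] [m2 [m2' [E2 ->]]].
exists (m1 + m2')%MM, (m1' + m2)%MM; split; last by rewrite !weightD; lia.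
rewrite !mpolyXD !rmorphM /= -E1 -E2.
by rewrite [X in _ * X]mulrCA -mulrA mulKf // mulrA.
Qed.

(** If [p / q] is the chosen representative of [z], then [p X^m = q X^m'] with [m] and [m']
    exchanged as in [E]; comparing minimal weights of both sides gives the value whatever [p] and
    [q] are. *)
Lemma valuation_laurent z n :
  laurent_monomial z n -> monomial_valuation a b z = Some n.
Proof.
move=> lz; have z0 := laurent_neq0 lz; case: lz => m [m' [zE ->]].
rewrite /monomial_valuation (negbTE z0).
have := embed_repr_num z; have d0 := denom_ratioP (repr z).
move: (frac (repr z)).1 (frac (repr z)).2 d0 => p q q0 pE.
have p0 : p != 0.
  apply/eqP => p0; have /eqP := pE; rewrite p0 rmorph0 eq_sym mulf_eq0 (negbTE z0).
  by rewrite tofrac_eq0 (negbTE q0).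
have E : p * 'X_[m'] = q * 'X_[m].
  by apply: embed_inj; rewrite !rmorphM /= pE -zE; ring.
have := congr1 (min_weight a b) E; rewrite !min_weightMX // => W.
by congr Some; lia.
Qed.

End Valuation.

(** * Exponents and values at the vertices *)

Section Tree.
Variables (k : fieldType) (a b : nat).
Local Notation P := {mpoly k[2]}.
Local Notation X := (polyx k).
Local Notation Y := (polyy k).

Lemma alg_indep_swap (f g : kxy k) : alg_indep f g -> alg_indep g f.
Proof.
move=> fg D; apply: (@subst_monomial_eq0 _ f g _ _ 1
  (fun m => bimon (m ord_max) (m ord0))) => // [m _|m n _ _ E].
  by rewrite !mnmE mul1r mulrC.
have := congr1 (fun m : 'X_{1..2} => m ord0) E.
have := congr1 (fun m : 'X_{1..2} => m ord_max) E.
by rewrite !mnmE => *; apply: mnm2P.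
Qed.

Lemma alg_indep_blowup (f g : kxy k) : f != 0 -> alg_indep f g -> alg_indep f (g / f).
Proof.
(* [N] bounds the exponents of [g / f], so [f^N] clears denominators and sends the exponent [(i, j)]
   injectively to [(N + i - j, j)]. *)
move=> f0 fg D; pose N := (\sum_(m <- msupp D) m ord_max)%N.
have leN (m : 'X_{1..2}) : m \in msupp D -> (m ord_max <= N)%N.
  by move=> mD; rewrite /N (bigD1_seq m) ?msupp_uniq //= leq_addr.
apply: (@subst_monomial_eq0 _ f g _ _ (f ^+ N)
  (fun m => bimon (N + m ord0 - m ord_max) (m ord_max))) => // [m /leN le|m n mD nD E].
  rewrite !mnmE /pair_fun /=; set e := (N + m ord0 - m ord_max)%N.
  by rewrite mulrA -exprD (_ : (N + m ord0 = e + m ord_max)%N) ?blowup_monomial //; lia.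
have := congr1 (fun m : 'X_{1..2} => m ord0) E.
have := congr1 (fun m : 'X_{1..2} => m ord_max) E.
rewrite !mnmE /pair_fun /= => E1 E0; apply: mnm2P => //.
by have := leN _ mD; have := leN _ nD; lia.
Qed.

(* [x = f^m1 g^m2], [y = f^n1 g^n2] with unimodular exponents; [al] and [be]
   are the values of [f] and [g]. *)
Record chart_data (f g : kxy k) (m1 m2 n1 n2 : nat) (al be : int) : Prop :=
  ChartData {
    cd_f : laurent_monomial a b f al;
    cd_g : laurent_monomial a b g be;
    cd_indep : alg_indep f g;
    cd_x : fx k = f ^+ m1 * g ^+ m2;
    cd_y : fy k = f ^+ n1 * g ^+ n2;
    cd_a : a%:Z = m1%:Z * al + m2%:Z * be;
    cd_b : b%:Z = n1%:Z * al + n2%:Z * be;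
    cd_det : (m1%:Z * n2%:Z - m2%:Z * n1%:Z) ^+ 2 = 1
  }.

(** The swap changes the sign of the determinant, which is why [cd_det] records only its square. *)
Lemma chart_data_swap f g m1 m2 n1 n2 al be :
  chart_data f g m1 m2 n1 n2 al be -> chart_data g f m2 m1 n2 n1 be al.
Proof.
case=> lf lg fg xE yE aE bE det; split=> //.
- exact: alg_indep_swap.
- by rewrite mulrC.
- by rewrite mulrC.
- by rewrite addrC.
- by rewrite addrC.
- by rewrite -det; ring.
Qed.

(** As [f^i g^j = f^(i+j) (g/f)^j], the exponent matrix undergoes a column operation, which keeps
    its determinant, while the values undergo a step of the subtractive Euclidean algorithm. The
    other successor is reached after a swap. *)
Lemma chart_data_blowup f g m1 m2 n1 n2 al be :
  chart_data f g m1 m2 n1 n2 al be ->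
  chart_data f (g / f) (m1 + m2) m2 (n1 + n2) n2 al (be - al).
Proof.
case=> lf lg fg xE yE aE bE det; have f0 := laurent_neq0 lf.
have monE i j := blowup_monomial g i j f0.
split=> //.
- exact: laurent_div.
- exact: alg_indep_blowup.
- by rewrite monE.
- by rewrite monE.
- by rewrite aE PoszD; ring.
- by rewrite bE PoszD; ring.
- by rewrite -det !PoszD; ring.
Qed.

Lemma tree_vertex_data (c : chart k) : tree_vertex c ->
  exists m1 m2 n1 n2 al be, chart_data (gen1 c) (gen2 c) m1 m2 n1 n2 al be.
Proof.
elim=> {c} [|c _ [m1 [m2 [n1 [n2 [al [be cd]]]]]]|c _ [m1 [m2 [n1 [n2 [al [be cd]]]]]]].
- exists 1%N, 0%N, 0%N, 1%N, a%:Z, b%:Z; split=> /=.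
  + exists U_(ord0)%MM, 0%MM; rewrite mpolyX0 rmorph1 mulr1; split=> //.
    by rewrite /weight !mnm1E !mnm0E /=; lia.
  + exists U_(ord_max)%MM, 0%MM; rewrite mpolyX0 rmorph1 mulr1; split=> //.
    by rewrite /weight !mnm1E !mnm0E /=; lia.
  + exact: alg_indep_fxy.
  + by rewrite mulr1.
  + by rewrite mul1r.
  + by rewrite mul1r mul0r addr0.
  + by rewrite mul1r mul0r add0r.
  + by [].
- by exists (m1 + m2)%N, m2, (n1 + n2)%N, n2, al, (be - al); apply: chart_data_blowup.
by exists (m2 + m1)%N, m1, (n2 + n1)%N, n1, be, (al - be);
  apply/chart_data_blowup/chart_data_swap.
Qed.

(** * The criterion in a single chart *)

Lemma binomial_resolvedP p1 p2 q1 q2 (al be : int) :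
    coprime `|al| `|be| -> (0 < al) || (0 < be) ->
    p1%:Z = q1%:Z + be -> q2%:Z = p2%:Z + al ->
    (al = 1 -> (0 < p2)%N) -> (be = 1 -> (0 < q1)%N) ->
  ~ resolved (X ^+ p1 * Y ^+ p2 - X ^+ q1 * Y ^+ q2) <-> 0 < al /\ 0 < be.
Proof.
move=> co pos p1E q2E p2_gt0 q1_gt0; split=> [nres|[al0 be0]].
  apply/andP; apply/negPn/negP => npos; apply: nres.
  (* If [al <= 0] then [be > 0], and the second monomial divides the first; if [al > 0] then
     [be <= 0], and the first divides the second. Both cases leave a hyperbola, up to sign. *)
  have [al_le0|al_gt0] := lerP al 0.
    have -> : p1 = (q1 + `|be|)%N by lia.
    have -> : p2 = (q2 + `|al|)%N by lia.
    have -> : X ^+ (q1 + `|be|) * Y ^+ (q2 + `|al|) - X ^+ q1 * Y ^+ q2 =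
      X ^+ q1 * Y ^+ q2 * (X ^+ `|be| * Y ^+ `|al| - 1) by rewrite !exprD; ring.
    by apply: hyperbola_resolved; rewrite coprime_sym.
  have -> : q1 = (p1 + `|be|)%N by lia.
  have -> : q2 = (p2 + `|al|)%N by lia.
  have -> : X ^+ p1 * Y ^+ p2 - X ^+ (p1 + `|be|) * Y ^+ (p2 + `|al|) =
    - (X ^+ p1 * Y ^+ p2 * (X ^+ `|be| * Y ^+ `|al| - 1)) by rewrite !exprD; ring.
  by apply/resolved_opp/hyperbola_resolved; rewrite coprime_sym.
(* With both values positive, each monomial exceeds the other in one variable, which leaves the
   cusp. *)
have -> : p1 = (q1 + `|be|)%N by lia.
have -> : q2 = (p2 + `|al|)%N by lia.
have -> : X ^+ (q1 + `|be|) * Y ^+ p2 - X ^+ q1 * Y ^+ (p2 + `|al|) =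
  X ^+ q1 * Y ^+ p2 * (X ^+ `|be| - Y ^+ `|al|) by rewrite !exprD; ring.
by apply: cusp_not_resolved => //; lia.
Qed.

Lemma unimodular_monomial (i j l n : nat) :
  (i%:Z * j%:Z - l%:Z * n%:Z) ^+ 2 = 1 -> (l * n = 0)%N -> i = 1%N /\ j = 1%N.
Proof.
move=> + ln0.
rewrite -!PoszM ln0 subr0 => /eqP; rewrite sqrf_eq1 => /orP[] /eqP ij; last by lia.
have /eqP : (i * j)%N = 1%N by case: ij.
by rewrite muln_eq1 => /andP[/eqP-> /eqP->].
Qed.

Lemma preimage_not_resolvedP f g m1 m2 n1 n2 al be :
    (1 < a)%N -> (1 < b)%N -> coprime a b ->
    chart_data f g m1 m2 n1 n2 al be ->
  preimage_not_resolved (X ^+ b - Y ^+ a) (adjoin f g) <-> 0 < al /\ 0 < be.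
Proof.
move=> a1 b1 co cd; have [_ _ fg xE yE aE bE det] := cd.
pose G := X ^+ (b * m1) * Y ^+ (b * m2) - X ^+ (a * n1) * Y ^+ (a * n2).
have GE : subst f g G = embed (X ^+ b - Y ^+ a).
  rewrite !rmorphB !rmorphM !rmorphXn /= substX substY -/(fx k) -/(fy k) xE yE.
  by rewrite !exprMn -!exprM ![(_ * b)%N]mulnC ![(_ * a)%N]mulnC.
have -> : preimage_not_resolved (X ^+ b - Y ^+ a) (adjoin f g) <-> ~ resolved G.
  split=> [[G' G'E]|nres]; last by exists G.
  (* Independence of [f] and [g] makes the equation of the preimage unique. *)
  suff -> : G' = G by [].
  apply/eqP; rewrite -subr_eq0; apply/eqP/fg.
  by rewrite rmorphB /= GE [subst f g G']G'E subrr.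
(* A common divisor of [al] and [be] divides their combinations [a] and [b]. *)
have co' : coprime `|al| `|be|.
  rewrite /coprime -dvdn1 -(eqP co) dvdn_gcd.
  have dal : ((gcdn `|al| `|be|)%:Z %| al)%Z by rewrite dvdzE dvdn_gcdl.
  have dbe : ((gcdn `|al| `|be|)%:Z %| be)%Z by rewrite dvdzE dvdn_gcdr.
  have da : ((gcdn `|al| `|be|)%:Z %| a%:Z)%Z by rewrite aE rpredD // dvdz_mull.
  have db : ((gcdn `|al| `|be|)%:Z %| b%:Z)%Z by rewrite bE rpredD // dvdz_mull.
  by move: da db; rewrite !dvdzE /= => -> ->.
(* [a > 0] is a combination of [al] and [be] with nonnegative coefficients. *)
have pos : (0 < al) || (0 < be) by apply/negPn/negP; nia.
have det_neg : (m2%:Z * n1%:Z - m1%:Z * n2%:Z) ^+ 2 = 1 by rewrite -det; ring.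
(* For [al = 1], [m2 = 0] would force [m1 = 1] and so [a = 1]; likewise [n2 = 0] would force
   [b = 1]. Hence both monomials of [G] contain the second variable, and its axis lies in the
   preimage. *)
have m2n2 : al = 1 -> (0 < m2)%N && (0 < n2)%N.
  move=> al1; rewrite al1 in aE bE; rewrite -muln_gt0 lt0n muln_eq0; apply/norP; split.
    apply/eqP => m20; have [|m11 _] := unimodular_monomial det.
      by rewrite m20.
    by move: aE; rewrite m20 m11; lia.
  apply/eqP => n20; have [|_ n11] := unimodular_monomial det_neg.
    by rewrite n20 muln0.
  by move: bE; rewrite n20 n11; lia.
have m1n1 : be = 1 -> (0 < m1)%N && (0 < n1)%N.
  move=> be1; rewrite be1 in aE bE; rewrite -muln_gt0 lt0n muln_eq0; apply/norP; split.
    apply/eqP => m10; have [|m21 _] := unimodular_monomial det_neg.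
      by rewrite m10.
    by move: aE; rewrite m10 m21; lia.
  apply/eqP => n10; have [|_ n21] := unimodular_monomial det.
    by rewrite n10 muln0.
  by move: bE; rewrite n10 n21; lia.
(* With determinant [e], the formulas for [a] and [b] give [b m1 - a n1 = e be] and
   [a n2 - b m2 = e al]. *)
have /orP[/eqP e|/eqP e] :
    (m1%:Z * n2%:Z - m2%:Z * n1%:Z == 1) || (m1%:Z * n2%:Z - m2%:Z * n1%:Z == -1).
  by rewrite -eqf_sqr det expr1n.
- apply: binomial_resolvedP => //.
  + rewrite !PoszM aE bE -[X in _ = _ + X]mul1r -e; ring.
  + rewrite !PoszM aE bE -[X in _ = _ + X]mul1r -e; ring.
  + by move=> /m2n2 /andP[? ?]; rewrite muln_gt0; lia.
  + by move=> /m1n1 /andP[? ?]; rewrite muln_gt0; lia.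
(* For determinant -1 the two monomials exchange roles, so the criterion is applied to [- G]. *)
have -> : ~ resolved G <-> ~ resolved (- G) by rewrite resolved_opp.
rewrite opprB; apply: binomial_resolvedP => //.
+ rewrite !PoszM aE bE -[X in _ = _ + X]opprK -mulN1r -e; ring.
+ rewrite !PoszM aE bE -[X in _ = _ + X]opprK -mulN1r -e; ring.
+ by move=> /m2n2 /andP[? ?]; rewrite muln_gt0; lia.
+ by move=> /m1n1 /andP[? ?]; rewrite muln_gt0; lia.
Qed.

(** * Comparison of the two subgraphs *)

Lemma tree_vertex_eq (c : chart k) : tree_vertex c -> c = adjoin (gen1 c) (gen2 c).
Proof. by case. Qed.

Lemma not_resolved_positive (c : chart k) :
    (1 < a)%N -> (1 < b)%N -> coprime a b -> tree_vertex c ->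
  preimage_not_resolved (X ^+ b - Y ^+ a) c <->
  valuation_positive (monomial_valuation a b) c.
Proof.
move=> a1 b1 co cT; rewrite (tree_vertex_eq cT).
have [m1 [m2 [n1 [n2 [al [be cd]]]]]] := tree_vertex_data cT.
rewrite (preimage_not_resolvedP a1 b1 co cd) /valuation_positive /=.
by rewrite (valuation_laurent (cd_f cd)) (valuation_laurent (cd_g cd)).
Qed.

End Tree.

(** Since edges join vertices, equivalence of the predicates on vertices is enough; extensionality
    turns it into equality of the graphs. *)
Lemma induced_subgraph_ext V (T : digraph V) (P Q : V -> Prop) :
    (forall c d, edges T c d -> vertices T c /\ vertices T d) ->
    (forall c, vertices T c -> (P c <-> Q c)) ->
  induced_subgraph T P = induced_subgraph T Q.
Proof.
move=> edgeT PQ; rewrite /induced_subgraph; congr Digraph.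
  apply: functional_extensionality => c; apply: propositional_extensionality.
  by split=> -[cT /(PQ c cT)].
apply: functional_extensionality => c; apply: functional_extensionality => d.
apply: propositional_extensionality.
by split=> -[e]; have [/PQ cPQ /PQ dPQ] := edgeT _ _ e => /cPQ ? /dPQ ?.
Qed.

Theorem theorem4p3 (k : fieldType) (a b : nat) :
  (1 < a)%N -> (1 < b)%N -> gcdn a b = 1%N -> (b < a)%N ->
  P_ab k a b = P_nu (@monomial_valuation k a b).
Proof.
move=> a1 b1 /eqP co _; apply: induced_subgraph_ext => [c d [cT dE]|c].
  by split=> //; case: dE => ->; constructor.
exact: not_resolved_positive.
Qed.
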